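(* Let $\gamma>-1$. For every integrable function $f:V\to\mathbb{C}$, $$\int_V f(x,y,t)\,d\nu_\gamma=\int_{\mathbb{B}^2}f(Q(u,v))\,d\mu_\gamma(u,v).$$ Equivalently, the pushforward measure satisfies $Q_\#\mu_\gamma=\nu_\gamma$.
   Context: $V=\{(x,y,t)\in\mathbb{R}^3:x^2+y^2=t^2,\ 0\le t\le1\}$, parametrized by $(x,y,t)=(t\cos\phi,t\sin\phi,t)$, with the probability measure $d\nu_\gamma(t,\phi)=\frac{\gamma+1}{2\pi}(1-t)^\gamma\,dt\,d\phi$ on $0\le t\le1$, $0\le\phi<2\pi$. $\mathbb{B}^2=\{(u,v)\in\mathbb{R}^2:u^2+v^2\le1\}$ carries the probability measure $d\mu_\gamma(u,v)=\frac{\gamma+1}{\pi}(1-u^2-v^2)^\gamma\,du\,dv$. The map $Q:\mathbb{B}^2\to V$ is $Q(u,v)=(u^2-v^2,\,2uv,\,u^2+v^2)$. *)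

(* Defs.v *)
From HB Require Import structures.
From mathcomp Require Import all_boot all_order all_algebra.
From mathcomp Require Import all_classical all_reals all_analysis.
From mathcomp Require Import measurable_realfun complex.
From mathcomp Require Import ring lra.

Set Implicit Arguments.
Unset Strict Implicit.
Unset Printing Implicit Defensive.

Import Order.TTheory GRing.Theory Num.Theory.
Import numFieldNormedType.Exports.

Local Open Scope classical_set_scope.
Local Open Scope ring_scope.

(* R^2 and R^3 with their Borel (product) sigma-algebras; a point (x, y, t) of
   R^3 is ((x, y), t). *)
Notation realPlane R := (measurableTypeR R * measurableTypeR R)%type.
Notation realSpace R :=
  (measurableTypeR R * measurableTypeR R * measurableTypeR R)%type.

Section with_density.
Context d (T : measurableType d) (R : realType).
Variables (m : {measure set T -> \bar R}) (D : set T) (w : T -> R).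

Definition with_density (A : set T) : \bar R :=
  (\int[m]_(x in A `&` D) (w x)%:E)%E.

Hypotheses (mD : measurable D) (mw : measurable_fun setT w).
Hypothesis w_ge0 : forall x, 0 <= w x.

Lemma with_density0 : with_density set0 = 0%E.
Proof. by rewrite /with_density set0I integral_set0. Qed.

Lemma with_density_ge0 A : (0 <= with_density A)%E.
Proof. by apply: integral_ge0 => x _; rewrite lee_fin. Qed.

Lemma with_density_sigma_additive : semi_sigma_additive with_density.
Proof.
move=> F mF tF mUF; rewrite /with_density setI_bigcupl; apply: cvg_toP.
  apply: ereal_nondecreasing_is_cvgn => a b ab.
  by apply: lee_sum_nneg_natr => // k _ _; exact: with_density_ge0.
rewrite ge0_integral_bigcup//=.
- by move=> k; exact: measurableI.
- by apply/measurable_funTS/measurable_EFinP.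
- by move=> x _; rewrite lee_fin.
- exact: trivIset_setIr.
Qed.

End with_density.

Section cone_and_disk.
Variable R : realType.

Definition cone : set (realSpace R) :=
  [set p | let: (x, y, t) := (p : R * R * R) in
           x ^+ 2 + y ^+ 2 = t ^+ 2 /\ 0 <= t <= 1].

Definition cone_param (p : realPlane R) : realSpace R :=
  let: (t, phi) := (p : R * R) in (t * cos phi, t * sin phi, t).

Definition cone_param_dom : set (realPlane R) := `[0, 1] `*` `[0, 2 * pi[.

Definition disk : set (realPlane R) :=
  [set p | let: (u, v) := (p : R * R) in u ^+ 2 + v ^+ 2 <= 1].

Definition Qmap (p : realPlane R) : realSpace R :=
  let: (u, v) := (p : R * R) in
  (u ^+ 2 - v ^+ 2, 2 * u * v, u ^+ 2 + v ^+ 2).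

Lemma Qmap_disk : set_fun disk cone Qmap.
Proof.
move=> [u v] /= uv1; split; first by ring.
by rewrite uv1 addr_ge0 ?sqr_ge0.
Qed.

Lemma cone_param_cone : set_fun cone_param_dom cone cone_param.
Proof.
move=> [t phi] [/= t01 _]; split; last by move: t01; rewrite in_itv.
by rewrite !exprMn -mulrDr cos2Dsin2 mulr1.
Qed.

(* The value of the powers at the boundary points where 1 - t or
   1 - u^2 - v^2 vanishes is immaterial: these points form a null set. *)
Definition cone_density (gamma : R) (p : realPlane R) : R :=
  (gamma + 1) / (2 * pi) * (1 - p.1) `^ gamma.

Definition disk_density (gamma : R) (p : realPlane R) : R :=
  (gamma + 1) / pi * (1 - p.1 ^+ 2 - p.2 ^+ 2) `^ gamma.

Definition lebesgue2 := (@lebesgue_measure R \x @lebesgue_measure R)%E.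

HB.instance Definition _ := Measure.on lebesgue2.

(* The hypothesis -1 < gamma only serves to equip the two set functions below
   with their structures of measures. *)
Definition cone_measure (gamma : R) (hgamma : -1 < gamma) :
    set (realSpace R) -> \bar R :=
  pushforward (with_density lebesgue2 cone_param_dom (cone_density gamma))
    cone_param.

Definition disk_measure (gamma : R) (hgamma : -1 < gamma) :
    set (realPlane R) -> \bar R :=
  with_density lebesgue2 disk (disk_density gamma).

Lemma measurable_cone_param_dom : measurable cone_param_dom.
Proof. by apply: measurableX; exact: measurable_itv. Qed.

Lemma measurable_sqr1 : measurable_fun setT (fun p : realPlane R => p.1 ^+ 2 : R).
Proof. by apply: measurable_funX; exact: measurable_fst. Qed.

Lemma measurable_sqr2 : measurable_fun setT (fun p : realPlane R => p.2 ^+ 2 : R).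
Proof. by apply: measurable_funX; exact: measurable_snd. Qed.

Lemma measurable_disk : measurable disk.
Proof.
have -> : disk = setT `&` [set p : realPlane R | p.1 ^+ 2 + p.2 ^+ 2 <= 1 :> R].
  by rewrite setTI; apply/seteqP; split=> -[].
apply: measurable_fun_le => //; apply: measurable_funD.
  exact: measurable_sqr1.
exact: measurable_sqr2.
Qed.

Lemma measurable_cone_density gamma : measurable_fun setT (cone_density gamma).
Proof.
apply: measurable_funM => //.
apply: (measurableT_comp (measurable_powR gamma)).
by apply: measurable_funB => //; exact: measurable_fst.
Qed.

Lemma measurable_disk_density gamma : measurable_fun setT (disk_density gamma).
Proof.
apply: measurable_funM => //.
apply: (measurableT_comp (measurable_powR gamma)).
apply: measurable_funB; last exact: measurable_sqr2.
by apply: measurable_funB => //; exact: measurable_sqr1.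
Qed.

Lemma cone_density_ge0 gamma p : -1 < gamma -> 0 <= cone_density gamma p.
Proof.
move=> hgamma; rewrite mulr_ge0 ?powR_ge0// divr_ge0 ?mulr_ge0 ?pi_ge0//; lra.
Qed.

Lemma disk_density_ge0 gamma p : -1 < gamma -> 0 <= disk_density gamma p.
Proof.
by move=> hgamma; rewrite mulr_ge0 ?powR_ge0// divr_ge0 ?pi_ge0//; lra.
Qed.

Lemma measurable_cone_param : measurable_fun setT cone_param.
Proof.
have -> : cone_param =
    (fun p => (((p.1 : R) * cos (p.2 : R), (p.1 : R) * sin (p.2 : R)), p.1)).
  by apply/funext => -[].
have m1 := @measurable_fst _ _ (measurableTypeR R) (measurableTypeR R).
have m2 := @measurable_snd _ _ (measurableTypeR R) (measurableTypeR R).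
apply: measurable_fun_pair => //; apply: measurable_fun_pair.
  apply: measurable_funM => //; apply: measurableT_comp m2.
  by apply: continuous_measurable_fun; exact: continuous_cos.
apply: measurable_funM => //; apply: measurableT_comp m2.
by apply: continuous_measurable_fun; exact: continuous_sin.
Qed.

End cone_and_disk.

Section measure_instances.
Variables (R : realType) (gamma : R) (hgamma : -1 < gamma).

HB.instance Definition _ := isMeasure.Build _ _ _ (disk_measure hgamma)
  (@with_density0 _ _ _ _ _ _)
  (@with_density_ge0 _ _ _ _ _ _ (fun p => disk_density_ge0 p hgamma))
  (@with_density_sigma_additive _ _ _ _ _ _ (@measurable_disk R)
    (measurable_disk_density gamma) (fun p => disk_density_ge0 p hgamma)).

Let wnu :=
  with_density (@lebesgue2 R) (@cone_param_dom R) (cone_density gamma).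

HB.instance Definition _ := isMeasure.Build _ _ _ wnu
  (@with_density0 _ _ _ _ _ _)
  (@with_density_ge0 _ _ _ _ _ _ (fun p => cone_density_ge0 p hgamma))
  (@with_density_sigma_additive _ _ _ _ _ _ (@measurable_cone_param_dom R)
    (measurable_cone_density gamma) (fun p => cone_density_ge0 p hgamma)).

Let nu0 : cone_measure hgamma set0 = 0%E.
Proof. exact: with_density0. Qed.

Let nu_ge0 A : (0 <= cone_measure hgamma A)%E.
Proof. by apply: with_density_ge0 => p; exact: cone_density_ge0. Qed.

Let nu_sigma_additive : semi_sigma_additive (cone_measure hgamma).
Proof.
move=> F mF tF mUF.
have mpre A : measurable A -> measurable (@cone_param R @^-1` A).
  by move=> mA; rewrite -[X in measurable X]setTI; exact: measurable_cone_param.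
rewrite /cone_measure /pushforward preimage_bigcup.
apply: (@measure_semi_sigma_additive _ _ _ wnu).
- by move=> n; exact: mpre.
- apply/trivIsetP => /= i j _ _ ij; rewrite -preimage_setI.
  by move/trivIsetP : tF => /(_ _ _ _ _ ij) ->//; rewrite preimage_set0.
- by rewrite -preimage_bigcup; exact: mpre.
Qed.

HB.instance Definition _ := isMeasure.Build _ _ _ (cone_measure hgamma)
  nu0 nu_ge0 nu_sigma_additive.

End measure_instances.

Section complex_integral.
Context d (T : measurableType d) (R : realType).
Variables (m : {measure set T -> \bar R}) (D : set T) (f : T -> R[i]).

Definition cintegrable : Prop :=
  m.-integrable D (fun x => (complex.Re (f x))%:E) /\
  m.-integrable D (fun x => (complex.Im (f x))%:E).

Definition cintegral : R[i] :=
  Complex (\int[m]_(x in D) complex.Re (f x))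
          (\int[m]_(x in D) complex.Im (f x)).

End complex_integral.

(* Main.v *)
(* [Qmap] is the complex squaring map, so it carries the rotation of the disk
   by [phi / 2] to the rotation of the cone by [phi]. Rotations preserve the
   Lebesgue measure, so averaging the integral of [g \o Qmap] over them
   replaces [g] by its mean over the horizontal circle of the cone at height
   [t = u^2 + v^2]. As the disk of squared radius [a] has area [pi * a], the
   image of the plane Lebesgue measure by [u^2 + v^2] is [pi] times that of the
   half-line, which is the integration in [t]. *)

From HB Require Import structures.
Require Import Defs.
From mathcomp Require Import all_boot all_order all_algebra.
From mathcomp Require Import all_classical all_reals all_analysis.
From mathcomp Require Import complex measurable_realfun ring lra.

Set Implicit Arguments.
Unset Strict Implicit.
Unset Printing Implicit Defensive.

Import Order.TTheory GRing.Theory Num.Theory.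
Import numFieldNormedType.Exports.
Local Open Scope classical_set_scope.
Local Open Scope ring_scope.

(** * Translation invariance of the Lebesgue measure on the line *)

Section translation.
Variable R : realType.
Notation mu := (@lebesgue_measure R).
Local Open Scope ereal_scope.

Lemma measurable_translation (a : R) :
  measurable_fun setT
    (fun x : measurableTypeR R => (x + a)%R : measurableTypeR R).
Proof. exact: measurable_funD. Qed.

(** The Lebesgue measure is determined by its values on the intervals []x, y]], and the preimage of
    such an interval is an interval of the same length. *)
Lemma lebesgue_measureD (a : R) (A : set (measurableTypeR R)) : measurable A ->
  pushforward mu (fun x : measurableTypeR R => (x + a)%R : measurableTypeR R) A
  = mu A.
Proof.
move=> mA; apply/esym/lebesgue_measure_unique => //=.
  exact: measurable_translation.
move=> _ _ [[x y]] _ <-; rewrite /pushforward.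
rewrite (_ : _ @^-1` _ = `](x - a)%R, (y - a)%R]%classic); last first.
  by apply/seteqP; split => z /=; rewrite !in_itv/= ltrBlDr lerBrDr.
rewrite !lebesgue_measure_itv/= !lte_fin ltrD2r; case: ifP => // _.
by rewrite -!EFinB; congr (_%:E); ring.
Qed.

Lemma ge0_integral_translation (f : R -> \bar R) (a : R) (D : set R) :
  measurable D ->
  measurable_fun setT f -> (forall x, 0 <= f x) ->
  \int[mu]_(x in (fun x => (x + a)%R) @^-1` D) f (x + a)%R =
  \int[mu]_(x in D) f x.
Proof.
move=> mD mf f0.
have := @ge0_integral_pushforward _ _ (measurableTypeR R) (measurableTypeR R) R
  _ (measurable_translation a) mu D f mD (measurable_funTS mf)
  (fun x _ => f0 x).
move=> <-.
apply: eq_measure_integral => [|? A mA _]; first exact: measurable_translation.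
exact: lebesgue_measureD.
Qed.

End translation.

(** * Rotation invariance of the Lebesgue measure on the plane *)

Section rotation.
Variable R : realType.
Notation mu := (@lebesgue_measure R).
Notation mu2 := (@lebesgue_measure R \x @lebesgue_measure R)%E.
Implicit Types (a : R) (p : realPlane R) (f : realPlane R -> \bar R).

Definition shear1 a p : realPlane R := ((p.1 : R) + a * p.2, p.2).

Definition shear2 a p : realPlane R := (p.1, (p.2 : R) + a * p.1).

Definition rotation a p : realPlane R :=
  (cos a * p.1 - sin a * p.2, sin a * p.1 + cos a * p.2).

Lemma measurable_shear1 a : measurable_fun setT (shear1 a).
Proof.
apply: measurable_fun_pair; last exact: measurable_snd.
apply: measurable_funD; first exact: measurable_fst.
by apply: measurable_funM => //; exact: measurable_snd.
Qed.

Lemma measurable_shear2 a : measurable_fun setT (shear2 a).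
Proof.
apply: measurable_fun_pair; first exact: measurable_fst.
apply: measurable_funD; first exact: measurable_snd.
by apply: measurable_funM => //; exact: measurable_fst.
Qed.

(** With the second coordinate fixed, the shear is a translation of the first; Tonelli with the
    first coordinate innermost reduces to translation invariance. *)
Lemma ge0_integral_shear1 f a :
  measurable_fun setT f -> (forall p, 0 <= f p)%E ->
  (\int[mu2]_p f (shear1 a p) = \int[mu2]_p f p)%E.
Proof.
move=> mf f0.
rewrite (fubini_tonelli2 (f \o shear1 a))//; last 2 first.
- exact: measurableT_comp (measurable_shear1 a).
- by move=> p; exact: f0.
rewrite (fubini_tonelli2 f)//.
apply: eq_integral => y _ /=.
have := @ge0_integral_translation R (fun x => f (x, y)) (a * y)%R setT.
rewrite preimage_setT; apply => //.
exact: measurableT_comp mf (@measurable_pair2 _ _ _ _ y).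
Qed.

Lemma ge0_integral_shear2 f a :
  measurable_fun setT f -> (forall p, 0 <= f p)%E ->
  (\int[mu2]_p f (shear2 a p) = \int[mu2]_p f p)%E.
Proof.
move=> mf f0.
rewrite (fubini_tonelli1 (f \o shear2 a))//; last 2 first.
- exact: measurableT_comp (measurable_shear2 a).
- by move=> p; exact: f0.
rewrite (fubini_tonelli1 f)//.
apply: eq_integral => x _ /=.
have := @ge0_integral_translation R (fun y => f (x, y)) (a * x)%R setT.
rewrite preimage_setT; apply => //.
exact: measurableT_comp mf (@measurable_pair1 _ _ _ _ x).
Qed.

(** The classical factorization of a rotation into three shears, through which rotations inherit the
    invariance known for shears. The angle is written as a double because the outer shears involve
    the tangent of the half angle. *)
Lemma rotation_shear a p : cos a != 0 ->
  rotation (a *+ 2) p = shear1 (- tan a) (shear2 (sin (a *+ 2))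
    (shear1 (- tan a) p)).
Proof.
case: p => x y ca0; rewrite /rotation /shear1 /shear2 /tan/=.
have -> : cos (a *+ 2) = cos a ^+ 2 - sin a ^+ 2.
  by rewrite mulr2n cosD -!expr2.
have -> : sin (a *+ 2) = 2 * (sin a * cos a) by rewrite mulr2n sinD; ring.
have := cos2Dsin2 a.
move: (cos a) (sin a) ca0 => c d c0 cd.
have {}cd : c ^+ 2 = 1 - d ^+ 2 by rewrite -cd; ring.
congr pair.
- have -> : 2 * (d * c) * y = 2 * (d / c) * y * (1 - d ^+ 2).
    by rewrite -cd; field.
  by rewrite cd; field.
- have -> : (c ^+ 2 - d ^+ 2) * y = y - 2 * d ^+ 2 * y by rewrite cd; ring.
  by field.
Qed.

Lemma ge0_integral_rotation f a : cos a != 0 ->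
  measurable_fun setT f -> (forall p, 0 <= f p)%E ->
  (\int[mu2]_p f (rotation (a *+ 2) p) = \int[mu2]_p f p)%E.
Proof.
move=> ca0 mf f0; set k := - tan a; set s := sin (a *+ 2).
have mf1 : measurable_fun setT (f \o shear1 k).
  exact: measurableT_comp (measurable_shear1 k).
have mf2 : measurable_fun setT (f \o shear1 k \o shear2 s).
  exact: measurableT_comp (measurable_shear2 s).
rewrite -(@ge0_integral_shear1 f k)//.
rewrite -(@ge0_integral_shear2 (f \o shear1 k) s)//.
rewrite -(@ge0_integral_shear1 (f \o shear1 k \o shear2 s) k)//.
- by apply: eq_integral => p _; rewrite rotation_shear.
- by move=> p; exact: f0.
- by move=> p; exact: f0.
Qed.

End rotation.

(** * The area of a disk, and the image of the plane Lebesgue measure under the squared norm *)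

Section disk_area.
Variable R : realType.
Notation mu := (@lebesgue_measure R).
Notation mu2 := (@lebesgue_measure R \x @lebesgue_measure R)%E.

Lemma derivable_oo_LRcontinuous_derivable (F : R -> R) (a b : R) :
  (forall x, derivable F x 1) -> derivable_oo_LRcontinuous F a b.
Proof.
move=> dF; have cF x : F y @[y --> x] --> F x.
  exact/differentiable_continuous/derivable1_diffP/dF.
split => [x _||]; [exact: dF|exact: cvg_at_right_filter (cF a)|].
exact: cvg_at_left_filter (cF b).
Qed.

(** Substitution of [r * sin x]: on [[- (pi / 2), pi / 2]] the cosine is nonnegative, so the square
    root becomes [r * cos x], and [P] is a primitive of the resulting integrand. *)
Lemma integral_half_circle (r : R) : 0 < r ->
  (\int[mu]_(x in `[(- r)%R, r]) (2 * Num.sqrt (r ^+ 2 - x ^+ 2))%:E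
   = (pi * r ^+ 2)%:E)%E.
Proof.
move=> r0; have pi0 := pi_gt0 R.
pose G x : R := 2 * Num.sqrt (r ^+ 2 - x ^+ 2).
pose F x : R := r * sin x.
pose P x : R := r ^+ 2 * (x + sin x * cos x).
have dF x : is_derive x (1 : R) F (r * cos x).
  by apply: is_derive_eq; rewrite /GRing.scale/=; ring.
have dP x : is_derive x (1 : R) P (2 * (r * cos x) ^+ 2).
  apply: is_derive_eq; rewrite /GRing.scale/=.
  have := cos2Dsin2 x; move: (cos x) (sin x) => c d cd.
  have -> : d * - d = c ^+ 2 - 1 by rewrite -cd; ring.
  by ring.
have F'E : derive1 F = (fun x => r * cos x).
  by apply/funext => x; rewrite derive1E; apply: derive_val.
have cF' : continuous (derive1 F : R -> R).
  by rewrite F'E => x; apply: cvgM; [exact: cvg_cst|exact: continuous_cos].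
have FN : F (- (pi / 2)) = - r by rewrite /F sinN sin_pihalf mulrN1.
have FP : F (pi / 2) = r by rewrite /F sin_pihalf mulr1.
have ab : - (pi / 2) < pi / 2 :> R by lra.
rewrite -[X in `[X, _]]FN -[X in `[_, X]]FP.
rewrite (@integration_by_substitution_increasing _ F G)//.
- transitivity (\int[mu]_(x in `[(- (pi / 2))%R, (pi / 2)%R])
      (2 * (r * cos x) ^+ 2)%:E)%E.
    apply: eq_integral => x; rewrite inE/= in_itv/= => xpi; congr EFin.
    have cx : 0 <= cos x by rewrite cos_ge0_pihalf.
    rewrite F'E; change (2 * Num.sqrt (r ^+ 2 - (r * sin x) ^+ 2) * (r * cos x)
      = 2 * (r * cos x) ^+ 2).
    rewrite (_ : r ^+ 2 - _ = (r * cos x) ^+ 2); last first.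
      by have := sin2cos2 x; rewrite !exprMn => ->; ring.
    rewrite sqrtr_sqr ger0_norm; first by ring.
    by rewrite mulr_ge0// ltW.
  rewrite (continuous_FTC2 (F := P))//.
  + by rewrite -EFinB /P cosN sinN cos_pihalf sin_pihalf; congr EFin; field.
  + apply: continuous_subspaceT => x; apply: cvgM; [exact: cvg_cst|].
    apply: (@continuous_comp _ _ _ (fun x : R => r * cos x)
      (fun x : R => x ^+ 2)); last exact: exprn_continuous.
    by apply: cvgM; [exact: cvg_cst|exact: continuous_cos].
  + by apply: derivable_oo_LRcontinuous_derivable => x; apply: ex_derive.
  + by move=> x _; rewrite derive1E; apply: derive_val.
- exact: ltW.
- by move=> x y xI yI xy; rewrite ltr_pM2l// ltr_sin.
- apply/cvg_ex; exists (derive1 F (- (pi / 2))).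
  exact: (cvg_at_right_filter (cF' _)).
- apply/cvg_ex; exists (derive1 F (pi / 2)).
  exact: (cvg_at_left_filter (cF' _)).
- by apply: derivable_oo_LRcontinuous_derivable => x; apply: ex_derive.
- apply: continuous_subspaceT => x; apply: cvgM; first exact: cvg_cst.
  apply: (@continuous_comp _ _ _ (fun x : R => r ^+ 2 - x ^+ 2) Num.sqrt);
    last exact: sqrt_continuous.
  by apply: cvgB; [exact: cvg_cst|exact: exprn_continuous].
Qed.

(** The vertical slices of the disk. For [a <= x ^+ 2] the square root takes its default value 0 and
    the interval is empty, as is the slice. *)
Lemma sqrD_lt_itv (a x : R) :
  [set y | x ^+ 2 + y ^+ 2 < a] =
  `](- Num.sqrt (a - x ^+ 2))%R, Num.sqrt (a - x ^+ 2)[%classic.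
Proof.
apply/seteqP; split => y /=; rewrite in_itv/= -ltr_norml -ltrBrDl.
  by move=> ya; rewrite -sqrtr_sqr ltr_sqrt// (le_lt_trans (sqr_ge0 y)).
move=> ya; have sa := le_lt_trans (normr_ge0 y) ya.
by rewrite sqrtr_gt0 in sa; rewrite -sqrtr_sqr ltr_sqrt in ya.
Qed.

(** The area is the integral of the chord lengths. The maximum with 0 covers a nonpositive squared
    radius, so that every open ray []-oo, a[] has a preimage of known measure under the squared
    norm. *)
Lemma open_disk_area (a : R) :
  mu2 [set p : realPlane R | (p.1 : R) ^+ 2 + (p.2 : R) ^+ 2 < a]
  = (pi * Num.max a 0)%:E.
Proof.
transitivity (\int[mu]_x (2 * Num.sqrt (a - x ^+ 2))%:E)%E.
  apply: eq_integral => x _ /=.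
  rewrite (_ : xsection _ _ = [set y | x ^+ 2 + y ^+ 2 < a]); last first.
    by apply/seteqP; split => y; rewrite /xsection/= inE.
  rewrite sqrD_lt_itv lebesgue_measure_itv/= lte_fin.
  have := sqrtr_ge0 (a - x ^+ 2); rewrite le_eqVlt => /predU1P[<-|s0].
    by rewrite mulr0 oppr0 ltxx.
  by rewrite ifT; [rewrite -EFinB; congr EFin; ring|lra].
have [a0|a0] := ltP 0 a; last first.
  rewrite integral0_eq ?mulr0// => x _; rewrite ler0_sqrtr ?mulr0//.
  by have := sqr_ge0 x; lra.
have r0 : 0 < Num.sqrt a by rewrite sqrtr_gt0.
transitivity (\int[mu]_(x in `[(- Num.sqrt a)%R, Num.sqrt a])
    (2 * Num.sqrt (Num.sqrt a ^+ 2 - x ^+ 2))%:E)%E; last first.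
  by rewrite integral_half_circle// sqr_sqrtr ?ltW.
(* Off the interval [a - x ^+ 2] is negative, so the square root is 0 and the integral over the
   whole line gains nothing. *)
rewrite [RHS]integral_mkcond; apply: eq_integral => x _.
rewrite patchE sqr_sqrtr ?ltW//; case: ifPn => //.
rewrite notin_setE/= in_itv/= -ler_norml => /negP; rewrite -ltNge => xa.
rewrite ler0_sqrtr ?mulr0// subr_le0.
have := sqr_sqrtr (ltW a0); have := real_normK (num_real x).
by move=> <- <-; rewrite lerXn2r ?nnegrE// ltW.
Qed.

(** The open left rays are stable under intersection, generate the Borel sets and exhaust the line
    with finite measure, so two measures that agree on them are equal. *)
Lemma measure_ray_unique (m : {measure set (measurableTypeR R) -> \bar R})
    (k : {nonneg R}) :
  (forall a : R, m `]-oo, a[%classic = (k%:num * Num.max a 0)%:E) ->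
  forall A, measurable A ->
  m A = (k%:num%:E * mu (A `&` `[0%R, +oo[))%E.
Proof.
move=> mE.
pose m' := mscale k (mrestr mu (measurable_itv `[(0:R), +oo[)).
move=> A mA; suff : m A = m' A by [].
have := @measure_unique _ R (measurableTypeR R) (@RGenInftyO.G R)
  (fun n => `]-oo, n%:R[%classic) _ _ _ _ m m' _ _ A mA; apply.
- exact: RGenInftyO.measurableE.
- move=> _ _ [x ->] [y ->]; exists (Num.min x y).
  by apply/seteqP; split => z /=; rewrite !in_itv/= lt_min;
    [move=> [-> ->]|move=> /andP].
- by move=> i; exists i%:R.
- apply/seteqP; split => // x _; exists (Num.bound `|x|) => //=.
  rewrite in_itv/=.
  exact: le_lt_trans (ler_norm _) (archi_boundP (normr_ge0 _)).
- move=> _ [a ->]; rewrite mE /m'/= /mscale/= /mrestr EFinM; congr (_ * _)%E.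
  rewrite (_ : _ `&` _ = `[0, a[%classic).
    rewrite lebesgue_measure_itv/= lte_fin.
    by case: ltP => a0; rewrite ?sube0//.
  by apply/seteqP; split => z /=; rewrite !in_itv/= andbT;
    [move=> [-> ->]|move=> /andP[-> ->]].
- by move=> n; rewrite mE ltry.
Qed.

Definition sqnorm (p : realPlane R) : R := (p.1 : R) ^+ 2 + (p.2 : R) ^+ 2.

Lemma measurable_sqnorm :
  measurable_fun setT (sqnorm : realPlane R -> measurableTypeR R).
Proof.
by apply: measurable_funD; [exact: measurable_sqr1|exact: measurable_sqr2].
Qed.

(** By [open_disk_area], the image of the plane measure under [sqnorm] and [pi] times the Lebesgue
    measure of the half-line agree on all open left rays. *)
Lemma ge0_integral_sqnorm (f : R -> \bar R) :
  measurable_fun setT f -> (forall t, 0 <= f t)%E ->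
  (\int[mu2]_p f (sqnorm p) = pi%:E * \int[mu]_(t in `[0%R, +oo[) f t)%E.
Proof.
move=> mf f0.
have := @ge0_integral_pushforward _ _ _ _ R _ measurable_sqnorm mu2 setT f
  measurableT mf (fun x _ => f0 x).
rewrite preimage_setT => <-.
pose m' := mscale (NngNum (pi_ge0 R))
  (mrestr mu (measurable_itv `[(0:R), +oo[)).
transitivity (\int[m']_t f t)%E.
  apply: eq_measure_integral => [|? A mA _]; first exact: measurable_sqnorm.
  apply: measure_ray_unique => // a /=; rewrite -open_disk_area.
  by congr (mu2 _); apply/seteqP; split => p /=; rewrite /sqnorm in_itv.
rewrite ge0_integral_mscale//; congr (_ * _)%E.
pose D : set (measurableTypeR R) := `[0%R, +oo[%classic.
have mD : measurable D by exact: measurable_itv.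
(* The complement of the half-line is null for the restricted measure; once it is removed, the
   restriction coincides with [mu] on the remaining subsets. *)
rewrite (@ge0_negligible_integral _ _ _ _ _ (~` D))//; last 2 first.
- exact: measurableC.
- by rewrite /= /mrestr setICl measure0.
rewrite setTD setCK; apply: eq_measure_integral => A mA AD.
by rewrite /= /mrestr setIidl.
Qed.

End disk_area.

(** * Polar angles, and integrals over a full period *)

Section angle.
Variable R : realType.
Notation mu := (@lebesgue_measure R).

Lemma polar_angle (x y t : R) : 0 <= t -> x ^+ 2 + y ^+ 2 = t ^+ 2 ->
  exists2 b : R, 0 <= b <= 2 * pi & x = t * cos b /\ y = t * sin b.
Proof.
have pi0 := pi_gt0 R.
rewrite le_eqVlt => /predU1P[<-|t0] xyt.
  exists 0; first by rewrite lexx mulr_ge0// ltW.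
  have := sqr_ge0 x; have := sqr_ge0 y => y0 x0.
  have /eqP : x ^+ 2 = 0 by lra.
  have /eqP : y ^+ 2 = 0 by lra.
  by rewrite !sqrf_eq0 !mul0r => /eqP -> /eqP ->.
pose c := x / t; pose s := y / t.
have xE : x = t * c by rewrite /c mulrC divfK// gt_eqF.
have yE : y = t * s by rewrite /s mulrC divfK// gt_eqF.
have cs : c ^+ 2 + s ^+ 2 = 1.
  by rewrite /c /s !expr_div_n -mulrDl xyt divff// sqrf_eq0 gt_eqF.
have c1 : -1 <= c <= 1.
  by have := sqr_ge0 s; move: cs; nra.
have sE : Num.sqrt (1 - c ^+ 2) = `|s|.
  by rewrite -sqrtr_sqr -cs; congr Num.sqrt; ring.
(* The arc cosine gives an angle whose sine is nonnegative; for negative [s] its reflection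
   [2 * pi - acos c] has the same cosine and the opposite sine. *)
rewrite xE yE; have [s0|s0] := leP 0 s.
  exists (acos c); last by rewrite acosK ?in_itv// sin_acos// sE ger0_norm.
  by rewrite acos_ge0//= (le_trans (acos_lepi c1))//; lra.
exists (- acos c + pi *+ 2).
  by have := acos_ge0 c1; have := acos_lepi c1; lra.
rewrite cosD2pi sinD2pi cosN sinN acosK ?in_itv// sin_acos// sE.
by rewrite ltr0_norm// opprK.
Qed.

(** The shifted interval [[b, T + b[] is cut at [T], and its tail [[T, T + b[] moves back by one
    period onto the missing piece [[0, b[]. *)
Lemma ge0_integral_periodic (f : R -> \bar R) (T b : R) :
  0 <= b <= T -> (forall x, f (x + T) = f x) ->
  measurable_fun setT f -> (forall x, 0 <= f x)%E ->
  (\int[mu]_(x in `[0%R, T[) f (x + b)%R = \int[mu]_(x in `[0%R, T[) f x)%E.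
Proof.
move=> /andP[b0 bT] fT mf f0.
have tr c x y : (\int[mu]_(z in `[x, y[) f (z + c)%R =
    \int[mu]_(z in `[(x + c)%R, (y + c)%R[) f z)%E.
  rewrite -(@ge0_integral_translation R f c `[(x + c)%R, (y + c)%R[%classic)//.
  congr (integral mu _ _).
  by apply/seteqP; split => z /=; rewrite !in_itv/= lerD2r ltrD2r.
have cut x y z : x <= y -> y <= z -> (\int[mu]_(w in `[x, z[) f w =
    \int[mu]_(w in `[x, y[) f w + \int[mu]_(w in `[y, z[) f w)%E.
  move=> xy yz; rewrite -ge0_integral_setU//=.
  - by rewrite -itv_bndbnd_setU.
  - exact: measurable_funTS.
  - rewrite disj_set2E; apply/eqP; rewrite -subset0 => w /=.
    rewrite !in_itv/= => -[/andP[_ wy] /andP[yw _]].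
    by have := lt_le_trans wy yw; rewrite ltxx.
rewrite tr add0r (cut b T); [|by []|lra].
have -> : (\int[mu]_(w in `[T, (T + b)%R[) f w =
    \int[mu]_(w in `[0%R, b[) f w)%E.
  rewrite -[X in `[X, _[](add0r T) [(T + b)%R]addrC -tr.
  by apply: eq_integral => x _; rewrite fT.
by rewrite addeC -cut.
Qed.

End angle.

(** * Tonelli's theorem with one variable confined to a subset *)

Section fubini_restrict.
Context d1 d2 (T1 : measurableType d1) (T2 : measurableType d2) (R : realType).
Variables (m1 : {sigma_finite_measure set T1 -> \bar R})
  (m2 : {sigma_finite_measure set T2 -> \bar R}).
Implicit Types f : T1 * T2 -> \bar R.

(** Extension by 0 off the strip [D]*[setT] reduces this to the unrestricted theorem. *)
Lemma fubini_tonelli_restrict (D : set T1) f :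
  measurable D -> measurable_fun setT f -> (forall z, (0 <= f z)%E) ->
  (\int[m1]_(x in D) \int[m2]_y f (x, y) =
   \int[m2]_y \int[m1]_(x in D) f (x, y))%E.
Proof.
move=> mD mf f0; pose g := f \_ (D `*` setT).
have gE x y : g (x, y) = ((fun x => f (x, y)) \_ D) x.
  by rewrite /g !patchE in_setX in_setT andbT.
transitivity (\int[m1]_x \int[m2]_y g (x, y))%E.
  rewrite integral_mkcond; apply: eq_integral => x _; rewrite patchE.
  case: ifPn => xD; first by apply: eq_integral => y _; rewrite gE patchE xD.
  by rewrite integral0_eq// => y _; rewrite gE patchE (negbTE xD).
rewrite fubini_tonelli//.
- apply: eq_integral => y _; rewrite [RHS]integral_mkcond.
  by apply: eq_integral => x _; rewrite gE.
- apply/measurable_restrict => //; first exact: measurableX.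
  exact: measurable_funTS.
- by move=> z; rewrite /g patchE; case: ifPn.
Qed.

Lemma measurable_fun_integral_restrict (D : set T2) f :
  measurable D -> measurable_fun setT f -> (forall z, (0 <= f z)%E) ->
  measurable_fun setT (fun x => \int[m2]_(y in D) f (x, y))%E.
Proof.
move=> mD mf f0; pose g := f \_ (setT `*` D).
have mg : measurable_fun setT g.
  apply/measurable_restrict => //; first exact: measurableX.
  exact: measurable_funTS.
have g0 z : (0 <= g z)%E by rewrite /g patchE; case: ifPn.
have := measurable_fun_fubini_tonelli_F (m2 := m2) g mg g0.
apply: eq_measurable_fun => x _; rewrite [RHS]integral_mkcond.
by apply: eq_integral => y _; rewrite /g !patchE in_setX in_setT.
Qed.

End fubini_restrict.

(** * Integration of functions composed with [Qmap], by averaging over rotations *)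

Section conic_coordinates.
Variable R : realType.
Notation mu := (@lebesgue_measure R).
Notation mu2 := (@lebesgue_measure R \x @lebesgue_measure R)%E.

(** Lets Tonelli exchange the angle with a point of the plane. The squares of an increasing
    exhaustion of the line have finite measure, and monotonicity puts both coordinates of a point in
    a common member. *)
Lemma lebesgue2_sigma_finite : sigma_finite setT (@lebesgue2 R).
Proof.
have /sigma_finiteP[F [TF ndF Foo]] := sigma_finiteT mu.
exists (fun n => F n `*` F n).
  apply/seteqP; split => // -[x y] _.
  have [n _ Fnx] : (\bigcup_n F n) x by rewrite -TF.
  have [m _ Fmy] : (\bigcup_n F n) y by rewrite -TF.
  exists (maxn n m) => //; split.
    by move: Fnx; exact/subsetPset/ndF/leq_maxl.
  by move: Fmy; exact/subsetPset/ndF/leq_maxr.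
move=> n; have [mF Foon] := Foo n; split; first exact: measurableX.
by rewrite /lebesgue2 product_measure1E// lte_mul_pinfty// ge0_fin_numE.
Qed.

HB.instance Definition _ := Measure_isSigmaFinite.Build _ _ _ (@lebesgue2 R)
  lebesgue2_sigma_finite.

Lemma measurable_Qmap : measurable_fun setT (@Qmap R).
Proof.
have -> : @Qmap R = (fun p => (((p.1 : R) ^+ 2 - (p.2 : R) ^+ 2,
    2 * (p.1 : R) * (p.2 : R)), (p.1 : R) ^+ 2 + (p.2 : R) ^+ 2)).
  by apply/funext => -[].
have m1 := @measurable_fst _ _ (measurableTypeR R) (measurableTypeR R).
have m2 := @measurable_snd _ _ (measurableTypeR R) (measurableTypeR R).
apply: measurable_fun_pair; last first.
  by apply: measurable_funD; [exact: measurable_sqr1|exact: measurable_sqr2].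
apply: measurable_fun_pair.
  by apply: measurable_funB; [exact: measurable_sqr1|exact: measurable_sqr2].
by apply: measurable_funM => //; exact: measurable_funM.
Qed.

(** Squaring doubles angles: [b] is the polar angle of [Qmap p] on its horizontal circle, and a
    rotation of [p] by [phi / 2] adds [phi] to it. The same [b] serves for all [phi], hence its
    place before the quantifier. *)
Lemma Qmap_rotation (p : realPlane R) : exists2 b : R, 0 <= b <= 2 * pi &
  forall phi, Qmap (rotation (phi / 2) p) = cone_param (sqnorm p, phi + b).
Proof.
case: p => u v.
have [] := @polar_angle R (u ^+ 2 - v ^+ 2) (2 * u * v) (u ^+ 2 + v ^+ 2).
- by rewrite addr_ge0// sqr_ge0.
- by ring.
move=> b bpi [xb yb]; exists b => // phi.
rewrite /Qmap /rotation /cone_param /sqnorm/=.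
have cE : cos phi = cos (phi / 2) ^+ 2 - sin (phi / 2) ^+ 2.
  by rewrite {1}[phi]splitr cosD -!expr2.
have sE : sin phi = 2 * (sin (phi / 2) * cos (phi / 2)).
  by rewrite {1}[phi]splitr sinD; ring.
have cs := cos2Dsin2 (phi / 2).
rewrite cosD sinD !mulrBr !mulrDr.
rewrite !(mulrCA (u ^+ 2 + v ^+ 2)) -xb -yb cE sE.
move: (cos (phi / 2)) (sin (phi / 2)) cs => c s cs.
congr (_, _, _); [ring|ring|].
by rewrite -[RHS]mul1r -cs; ring.
Qed.

Lemma measurable_rotation_half :
  measurable_fun setT (fun z : measurableTypeR R * realPlane R =>
    rotation ((z.1 : R) / 2) z.2).
Proof.
have mp1 : measurable_fun setT
    (fun z : measurableTypeR R * realPlane R => z.2.1).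
  by apply: measurableT_comp; [exact: measurable_fst|exact: measurable_snd].
have mp2 : measurable_fun setT
    (fun z : measurableTypeR R * realPlane R => z.2.2).
  by apply: measurableT_comp; [exact: measurable_snd|exact: measurable_snd].
have mh : measurable_fun setT
    (fun z : measurableTypeR R * realPlane R => (z.1 : R) / 2).
  by apply: measurable_funM => //; exact: measurable_fst.
have mc : measurable_fun setT
    (fun z : measurableTypeR R * realPlane R => cos ((z.1 : R) / 2)).
  by apply: measurableT_comp mh; apply: continuous_measurable_fun;
    exact: continuous_cos.
have ms : measurable_fun setT
    (fun z : measurableTypeR R * realPlane R => sin ((z.1 : R) / 2)).
  by apply: measurableT_comp mh; apply: continuous_measurable_fun;
    exact: continuous_sin.
apply: measurable_fun_pair.
  by apply: measurable_funB; exact: measurable_funM.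
by apply: measurable_funD; exact: measurable_funM.
Qed.

(** The factor [2^-1] is the [pi] of the disk area divided by the length [2 * pi] of the interval of
    angles over which the rotations are averaged. *)
Lemma ge0_integral_Qmap (g : realSpace R -> \bar R) :
  measurable_fun setT g -> (forall x, 0 <= g x)%E ->
  (\int[mu2]_p g (Qmap p) = 2^-1%:E * \int[mu]_(t in `[0%R, +oo[)
     \int[mu]_(phi in `[0%R, (2 * pi)%R[) g (cone_param (t, phi)))%E.
Proof.
move=> mg g0; have pi0 := pi_gt0 R.
pose D : set (measurableTypeR R) := `[0%R, (2 * pi)%R[%classic.
have mD : measurable D by exact: measurable_itv.
have muD : mu D = (2 * pi)%:E.
  by rewrite /D lebesgue_measure_itv/= lte_fin mulr_gt0// sube0.
have mgQ : measurable_fun setT (g \o @Qmap R).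
  exact: measurableT_comp mg measurable_Qmap.
have gQ0 p : (0 <= (g \o @Qmap R) p)%E by exact: g0.
set I := LHS.
pose k (z : measurableTypeR R * realPlane R) :=
  g (Qmap (rotation ((z.1 : R) / 2) z.2)).
have mk : measurable_fun setT k.
  exact: measurableT_comp mgQ measurable_rotation_half.
have k0 z : (0 <= k z)%E by exact: g0.
pose h (z : realPlane R) := g (cone_param z).
have mh : measurable_fun setT h.
  exact: measurableT_comp mg (@measurable_cone_param R).
have IE phi : D phi -> (\int[mu2]_p k (phi, p) = I)%E.
  rewrite /D/= in_itv/= => /andP[phi0 phi2pi].
  (* The rotation by [phi / 2] is written as the double of [phi / 4], which lies in [[0, pi / 2[],
     where the cosine is nonzero as the shear factorization requires. *)
  have -> : I = (\int[mu2]_p (g \o @Qmap R) (rotation (phi / 4 *+ 2) p))%E.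
    rewrite ge0_integral_rotation// ?gt_eqF//.
    by apply: cos_gt0_pihalf; apply/andP; split; lra.
  apply: eq_integral => p _; rewrite /k/=.
  by congr (g (Qmap (rotation _ _))); field.
have h0 z : (0 <= h z)%E by exact: g0.
have avg : (\int[mu]_(phi in D) \int[@lebesgue2 R]_p k (phi, p) =
    \int[@lebesgue2 R]_p \int[mu]_(phi in D) k (phi, p))%E.
  exact: fubini_tonelli_restrict.
have lhsE : (\int[mu]_(phi in D) \int[@lebesgue2 R]_p k (phi, p) =
    I * (2 * pi)%:E)%E.
  by rewrite -muD -integral_cst//; apply: eq_integral => x /set_mem; exact: IE.
(* For fixed [p] the integral over the angle is that of a periodic function shifted by the polar
   angle [b]. Periodicity removes [b], leaving a function of [sqnorm p] alone. *)
have rhsE : (\int[@lebesgue2 R]_p \int[mu]_(phi in D) k (phi, p) =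
    pi%:E * \int[mu]_(t in `[0%R, +oo[) \int[mu]_(phi in D) h (t, phi))%E.
  rewrite -ge0_integral_sqnorm; last 2 first.
  - exact: (measurable_fun_integral_restrict _ mD mh h0).
  - by move=> t; apply: integral_ge0.
  apply: eq_integral => p _; have [b bpi QE] := Qmap_rotation p.
  rewrite -(@ge0_integral_periodic R (fun phi => h (sqnorm p, phi)) _ b)//.
  - by apply: eq_integral => phi _; exact: (congr1 g (QE phi)).
  - by move=> x; rewrite /h /cone_param/= mulr_natl cosD2pi sinD2pi.
  - exact: measurableT_comp mh (@measurable_pair1 _ _ _ _ _).
(* [I] may be infinite; only the finite nonzero factor [2 * pi] is inverted. *)
have -> : I = (((2 * pi)^-1)%:E * (I * (2 * pi)%:E))%E.
  by rewrite muleCA -EFinM mulVf ?mule1// gt_eqF// mulr_gt0.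
by rewrite -lhsE avg rhsE muleA -EFinM invfM -mulrA mulVf ?mulr1// gt_eqF.
Qed.

End conic_coordinates.

(** * The image of the disk measure under [Qmap] *)

Section pushforward_measure.
Variable R : realType.
Notation mu := (@lebesgue_measure R).
Notation mu2 := (@lebesgue_measure R \x @lebesgue_measure R)%E.
Variables (gamma : R) (hgamma : -1 < gamma).

(** The disk density depends only on the height [u ^+ 2 + v ^+ 2] of the image point, so it factors
    through [Qmap] as [w]. The factor [2^-1] of [ge0_integral_Qmap] turns its constant into that of
    [cone_density]. *)
Lemma pushforward_Qmap_disk (A : set (realSpace R)) : measurable A ->
  pushforward (disk_measure hgamma) (@Qmap R) A = cone_measure hgamma A.
Proof.
move=> mA; have pi0 := pi_gt0 R.
pose w (t : R) : R := (gamma + 1) / pi * (1 - t) `^ gamma.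
have w0 t : 0 <= w t.
  by rewrite /w mulr_ge0 ?powR_ge0// divr_ge0 ?pi_ge0// -lerBlDr sub0r ltW.
have mw : measurable_fun setT w.
  apply: measurable_funM => //.
  apply: (measurableT_comp (measurable_powR gamma)).
  exact: measurable_funB.
(* The bound on the height pulls back to the disk under [Qmap], and to [t <= 1] under [cone_param];
   the bound [0 <= t] comes from the half-line of integration. *)
pose B : set (realSpace R) := A `&` [set q | (q.2 : R) <= 1].
have mB : measurable B.
  apply: measurableI => //.
  have -> : [set q : realSpace R | (q.2 : R) <= 1] =
      setT `&` [set q : realSpace R | (q.2 : R) <= 1] by rewrite setTI.
  by apply: measurable_fun_le => //; exact: measurable_snd.
pose g := (fun q : realSpace R => (w (q.2 : R))%:E) \_ B.
have mg : measurable_fun setT g.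
  apply/measurable_restrict => //; apply: measurable_funTS.
  apply/measurable_EFinP; apply: (measurableT_comp mw); exact: measurable_snd.
have g0 q : (0 <= g q)%E.
  by rewrite /g patchE; case: ifPn => // _; rewrite lee_fin.
have -> : pushforward (disk_measure hgamma) (@Qmap R) A
    = (\int[mu2]_p g (Qmap p))%E.
  rewrite /pushforward /disk_measure /with_density.
  rewrite [LHS]integral_mkcond; apply: eq_integral => -[u v] _.
  rewrite /g !patchE.
  have -> : ((u, v) \in @Qmap R @^-1` A `&` @disk R) = (Qmap (u, v) \in B).
    by apply/idP/idP; rewrite !inE.
  case: ifPn => // _; congr EFin; rewrite /disk_density /w /=.
  by congr (_ * _ `^ _); ring.
rewrite ge0_integral_Qmap//.
pose D : set (measurableTypeR R) := `[0%R, (2 * pi)%R[%classic.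
have mD : measurable D by exact: measurable_itv.
pose h (z : realPlane R) := (2^-1%:E * g (cone_param z))%E.
have h0 z : (0 <= h z)%E by rewrite mule_ge0.
have mgc : measurable_fun setT (fun z => g (@cone_param R z)).
  exact: measurableT_comp mg (@measurable_cone_param R).
have mh : measurable_fun setT h by exact: measurable_funeM.
have mhD : measurable_fun setT (h \_ (`[0%R, +oo[ `*` D)).
  apply/measurable_restrict => //; first exact: measurableX.
  exact: measurable_funTS.
(* The cone measure is put in the form of a plane integral over the half-strip of parameters, ready
   for Tonelli to produce the iterated integral of the other side. *)
have -> : cone_measure hgamma A = (\int[mu2]_z (h \_ (`[0%R, +oo[ `*` D)) z)%E.
  rewrite /cone_measure /pushforward /with_density.
  rewrite [LHS]integral_mkcond; apply: eq_integral => -[t phi] _.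
  have E : ((t, phi) \in @cone_param R @^-1` A `&` @cone_param_dom R) =
      ((t, phi) \in `[0, +oo[ `*` D) && (cone_param (t, phi) \in B).
    apply/idP/andP; rewrite !inE /B /D /cone_param_dom /=
      !in_itv/= !andbT.
      by move=> [At [/andP[t0 t1] phi2]].
    by move=> [[t0 phi2] [At t1]]; rewrite t0 t1.
  rewrite !patchE E; case: (_ \in _ `*` _) => //=.
  rewrite /h /g patchE; case: ifPn => _; last by rewrite mule0.
  by rewrite -EFinM /cone_density/= /w invfM; congr EFin; ring.
rewrite fubini_tonelli1//; last first.
  by move=> z; rewrite patchE; case: ifPn.
rewrite -ge0_integralZl//; last 2 first.
- apply/measurable_funTS.
  exact: (measurable_fun_integral_restrict mu mD mgc (fun z => g0 _)).
- by move=> t _; apply: integral_ge0.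
rewrite integral_mkcond; apply: eq_integral => t _; rewrite patchE.
case: ifPn => t0; last first.
  rewrite /fubini_F integral0_eq// => phi _.
  by rewrite patchE in_setX (negbTE t0).
rewrite -ge0_integralZl//; last first.
  apply/measurable_funTS.
  exact: measurableT_comp mgc (@measurable_pair1 _ _ _ _ _).
rewrite integral_mkcond; apply: eq_integral => phi _.
by rewrite !patchE in_setX t0.
Qed.

End pushforward_measure.

(** * Transfer of integrability and of integrals along an image measure *)

Section integrable_pushforward.
Context d1 d2 (X : measurableType d1) (Y : measurableType d2) (R : realType).
Variables (phi : X -> Y) (m : {measure set X -> \bar R})
  (n : {measure set Y -> \bar R}) (D : set Y) (f : Y -> \bar R).
Hypotheses (mphi : measurable_fun setT phi) (mD : measurable D)
  (mn : forall A, measurable A -> pushforward m phi A = n A)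
  (intf : n.-integrable D f).

(* [f] need not be measurable outside of [D], so it is first extended by 0. *)
Let g := f \_ D.

Let mg : measurable_fun setT g.
Proof.
by apply/measurable_restrict => //; rewrite setTI; exact: measurable_int intf.
Qed.

Let gE : {in D, g =1 f}.
Proof. by move=> y yD; rewrite /g patchE yD. Qed.

Let gphiE : {in phi @^-1` D, g \o phi =1 f \o phi}.
Proof. by move=> x /set_mem xD; apply: gE; exact/mem_set. Qed.

(** The change of variables for nonnegative functions, applied to the absolute value of [g], gives
    the same finite integral as for [f] on [D]. *)
Let int_gphi : m.-integrable (phi @^-1` D) (g \o phi).
Proof.
have mphiD : measurable (phi @^-1` D).
  by rewrite -[X in measurable X]setTI; exact: mphi.
apply/integrableP; split.
  by apply: measurable_funTS; exact: measurableT_comp mg mphi.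
have mag : measurable_fun D (fun y => `|g y|%E).
  by apply: measurable_funTS; exact: measurableT_comp.
have := @ge0_integral_pushforward _ _ _ _ R phi mphi m D _ mD mag
  (fun y _ => abse_ge0 (g y)).
rewrite /comp => <-; rewrite (@eq_measure_integral _ _ _ _ n); last first.
  by move=> A mA _; exact: mn.
have -> : (\int[n]_(y in D) `|g y| = \int[n]_(y in D) `|f y|)%E.
  by apply: eq_integral => y yD; rewrite gE.
by have /integrableP[] := intf.
Qed.

Lemma integrable_comp_pushforward : m.-integrable (phi @^-1` D) (f \o phi).
Proof.
apply: eq_integrable gphiE int_gphi.
by rewrite -[X in measurable X]setTI; exact: mphi.
Qed.

Lemma integral_comp_pushforward :
  (\int[n]_(y in D) f y = \int[m]_(x in phi @^-1` D) f (phi x))%E.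
Proof.
transitivity (\int[pushforward m phi]_(y in D) g y)%E.
  rewrite -(eq_integral _ _ gE).
  by apply: eq_measure_integral => A mA _; exact/esym/mn.
rewrite (integral_pushforward mphi mg int_gphi mD).
exact: eq_integral.
Qed.

End integrable_pushforward.

(** * The cone as a measurable domain, and the final assembly *)

Section cone.
Variable R : realType.

Lemma measurable_cone : measurable (@cone R).
Proof.
have mt : measurable_fun setT (fun q : realSpace R => q.2 : R).
  exact: measurable_snd.
have mt2 : measurable_fun setT (fun q : realSpace R => (q.2 : R) ^+ 2).
  exact: measurable_funX.
have mxy : measurable_fun setT (fun q : realSpace R => sqnorm q.1).
  by apply: measurableT_comp (@measurable_sqnorm R) _; exact: measurable_fst.
have mle (f g : realSpace R -> R) : measurable_fun setT f ->
    measurable_fun setT g -> measurable [set q | f q <= g q].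
  move=> mf mg; rewrite -[X in measurable X]setTI.
  exact: measurable_fun_le.
have -> : @cone R =
    ([set q : realSpace R | sqnorm q.1 <= (q.2 : R) ^+ 2]
     `&` [set q : realSpace R | (q.2 : R) ^+ 2 <= sqnorm q.1])
    `&` ([set q : realSpace R | 0 <= (q.2 : R)]
     `&` [set q : realSpace R | (q.2 : R) <= 1]).
  apply/seteqP; split => -[[x y] t] /=.
    by move=> [xyt /andP[-> ->]]; rewrite /sqnorm/= xyt.
  by move=> [[xyt txy] [t0 t1]]; split; [apply/le_anti/andP|apply/andP].
by apply: measurableI; apply: measurableI; exact: mle.
Qed.

(** Outside the disk the height of the image exceeds 1. This makes the disk the domain of the
    integrals pulled back from the cone. *)
Lemma preimage_Qmap_cone : @Qmap R @^-1` @cone R = @disk R.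
Proof.
apply/seteqP; split => p; last exact: Qmap_disk.
by case: p => u v /= [_ /andP[]].
Qed.

End cone.

Theorem theorem3p1 (R : realType) (gamma : R) (hgamma : -1 < gamma) :
  (forall f : realSpace R -> R[i],
     cintegrable (cone_measure hgamma) (@cone R) f ->
     cintegrable (disk_measure hgamma) (@disk R) (f \o @Qmap R) /\
     cintegral (cone_measure hgamma) (@cone R) f =
       cintegral (disk_measure hgamma) (@disk R) (f \o @Qmap R)) /\
  (forall A : set (realSpace R), measurable A ->
     pushforward (disk_measure hgamma) (@Qmap R) A = cone_measure hgamma A).
Proof.
split; last exact: pushforward_Qmap_disk.
move=> f [iRe iIm].
have mQ := @measurable_Qmap R; have mC := @measurable_cone R.
have QE := pushforward_Qmap_disk hgamma.
(* Real and imaginary parts are transferred separately, as extended real integrals; [Rintegral] then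
   takes their finite values. *)
have iReQ := integrable_comp_pushforward mQ mC QE iRe.
have iImQ := integrable_comp_pushforward mQ mC QE iIm.
have ReE := integral_comp_pushforward mQ mC QE iRe.
have ImE := integral_comp_pushforward mQ mC QE iIm.
rewrite preimage_Qmap_cone in iReQ iImQ ReE ImE.
by split; [split|congr Complex; rewrite /Rintegral ?ReE ?ImE].
Qed.
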